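(* Suppose there exist $\kappa\ge 1$ and $\delta,\theta$ with $\delta<1$ and $\theta\le (1-\delta)/2$ such that $\|\kappa^{-1}\mathbf{H}_t^{(T)}-\mathbf{I}\|\le\delta$ for all $T\ge 0$, $0\le t\le T$, and $\|\mathbf{E}_t\|\le\kappa\theta$ for all $t\ge 0$. Let $$\epsilon_* = \frac{1+\delta}{2}-\sqrt{\frac{(1-\delta)^2}{4}-\theta^2},$$ and suppose that $\theta<1-\epsilon_*$ and that the $\mathbf{y}_t$ are bounded, with $$M_y=\sup_{t\ge 0}\left\|\begin{bmatrix}\mathbf{y}_t\\ \mathbf{y}_{t+1}\end{bmatrix}\right\|<\infty.$$ Under these conditions the untruncated solutions converge: there exist $\mathbf{x}_t^*$ with $\hat{\mathbf{x}}_{t|T}\to\mathbf{x}_t^*$ as $T\to\infty$, and a constant $C(\epsilon_*,\theta,\delta)$ such that $$\|\hat{\mathbf{x}}_{t|T}-\mathbf{x}_t^*\|\le C(\epsilon_*,\theta,\delta)\,M_y\left(\frac{\theta}{1-\epsilon_*}\right)^{T-t}\qquad\text{for all } t\le T.$$ Let $\{\mathbf{x}_t^*\}$ be these untruncated asymptotic solutions and let $\{\mathbf{z}_t^*\}$ be the final truncated solutions for a buffer of size $B$. Then, with the same constant $C(\epsilon_*,\theta,\delta)$, $$\|\mathbf{x}_t^*-\mathbf{z}_t^*\|\le C(\epsilon_*,\theta,\delta)\,M_y\left(\frac{\theta}{1-\epsilon_*}\right)^{B}\qquad\text{for all } 0\le t\le T-B,$$ where $T$ is the current time index.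
   Context: Streaming least squares. Data: matrices $\mathbf{A}_t\in\mathbb{R}^{m\times n}$ ($t\ge 0$), $\mathbf{B}_t\in\mathbb{R}^{m\times n}$ ($t\ge1$), vectors $\mathbf{y}_t\in\mathbb{R}^m$ ($t\ge 0$), and a regularization parameter $\gamma\ge 0$. For each $T\ge 0$, $(\hat{\mathbf{x}}_{0|T},\dots,\hat{\mathbf{x}}_{T|T})$, with blocks in $\mathbb{R}^n$, denotes the minimizer over $(\mathbf{x}_0,\dots,\mathbf{x}_T)$ of $$\|\mathbf{A}_0\mathbf{x}_0-\mathbf{y}_0\|^2+\gamma\|\mathbf{x}_0\|^2+\sum_{t=1}^T\left(\|\mathbf{B}_t\mathbf{x}_{t-1}+\mathbf{A}_t\mathbf{x}_t-\mathbf{y}_t\|^2+\gamma\|\mathbf{x}_t\|^2\right).$$ The normal equations form a block-tridiagonal system with diagonal blocks $\mathbf{H}_t^{(T)}=\mathbf{A}_t^\top\mathbf{A}_t+\mathbf{B}_{t+1}^\top\mathbf{B}_{t+1}+\gamma\mathbf{I}$ for $0\le t\le T-1$ and $\mathbf{H}_T^{(T)}=\mathbf{A}_T^\top\mathbf{A}_T+\gamma\mathbf{I}$, subdiagonal blocks $\mathbf{E}_t=\mathbf{A}_{t+1}^\top\mathbf{B}_{t+1}$ and superdiagonal blocks $\mathbf{E}_t^\top$. The streaming solver computes the solution by an exact forward block-LU sweep followed by backward substitution: with $\mathbf{g}_s=\mathbf{A}_s^\top\mathbf{y}_s+\mathbf{B}_{s+1}^\top\mathbf{y}_{s+1}$ for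 $s<T$ and $\mathbf{g}_T=\mathbf{A}_T^\top\mathbf{y}_T$, set $\mathbf{Q}_0=\mathbf{H}_0^{(T)}$, $\mathbf{U}_{s-1}=\mathbf{Q}_{s-1}^{-1}\mathbf{E}_{s-1}^\top$, $\mathbf{Q}_s=\mathbf{H}_s^{(T)}-\mathbf{E}_{s-1}\mathbf{U}_{s-1}$, $\mathbf{v}_0=\mathbf{Q}_0^{-1}\mathbf{g}_0$, $\mathbf{v}_s=\mathbf{Q}_s^{-1}(\mathbf{g}_s-\mathbf{E}_{s-1}\mathbf{v}_{s-1})$, then $\hat{\mathbf{x}}_{T|T}=\mathbf{v}_T$ and $\hat{\mathbf{x}}_{s|T}=\mathbf{v}_s-\mathbf{U}_s\hat{\mathbf{x}}_{s+1|T}$ for $s=T-1,\dots,0$. Truncated solutions $\hat{\mathbf{z}}_{t|T}$ with buffer size $B$: the forward sweep is unchanged (and exact), but the backward substitution at each time $T$ is terminated early, so that only the most recent frames in the buffer are updated and older frames keep their last computed value. Thus frame $t$ agrees with the untruncated solution while it is in the buffer, $\hat{\mathbf{z}}_{t|T}=\hat{\mathbf{x}}_{t|T}$ for $T=t,\dots,t+B$, and its final value is $\mathbf{z}_t^*=\hat{\mathbf{z}}_{t|t+B}$. $\|\cdot\|$ is the Euclidean norm for vectors and the induced operator norm for matrices. *)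

(* Defs.v *)
From HB Require Import structures.
From mathcomp Require Import all_boot all_order all_algebra.
From mathcomp Require Import all_classical all_reals all_analysis.

Set Implicit Arguments.
Unset Strict Implicit.
Unset Printing Implicit Defensive.

Import Order.TTheory GRing.Theory Num.Theory.
Import numFieldNormedType.Exports.

Local Open Scope classical_set_scope.
Local Open Scope ring_scope.

(* The library norm `|_| on matrices is the entrywise sup norm; the Euclidean
   and induced operator norms are therefore defined here. *)
Definition enorm (R : realType) (k : nat) (x : 'cV[R]_k) : R :=
  Num.sqrt (\sum_(i < k) x i 0 ^+ 2).

Definition opnorm (R : realType) (k l : nat) (M : 'M[R]_(k, l)) : R :=
  sup [set enorm (M *m x) | x in [set x : 'cV[R]_l | enorm x <= 1]].

Section StreamingLeastSquares.
Context {R : realType} {m n : nat}.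

(* [B 0] is never used: the data [B t] only matters for [t >= 1]. *)
Context (A B : nat -> 'M[R]_(m, n)) (y : nat -> 'cV[R]_m) (gamma : R).

(* Candidates (x_0, ..., x_T) are represented by sequences of which only the
   entries of index at most T are read. *)
Definition ls_objective (T : nat) (x : nat -> 'cV[R]_n) : R :=
  enorm (A 0 *m x 0%N - y 0%N) ^+ 2 + gamma * enorm (x 0%N) ^+ 2 +
  \sum_(1 <= t < T.+1)
     (enorm (B t *m x t.-1 + A t *m x t - y t) ^+ 2
      + gamma * enorm (x t) ^+ 2).

Definition is_ls_minimizer (T : nat) (x : nat -> 'cV[R]_n) : Prop :=
  forall x' : nat -> 'cV[R]_n, ls_objective T x <= ls_objective T x'.

Definition diag_block (T t : nat) : 'M[R]_n :=
  if (t < T)%N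
  then (A t)^T *m A t + (B t.+1)^T *m B t.+1 + gamma%:M
  else (A t)^T *m A t + gamma%:M.

Definition subdiag_block (t : nat) : 'M[R]_n := (A t.+1)^T *m B t.+1.

Definition rhs_block (T s : nat) : 'cV[R]_n :=
  if (s < T)%N
  then (A s)^T *m y s + (B s.+1)^T *m y s.+1
  else (A s)^T *m y s.

Fixpoint Qblock (T s : nat) : 'M[R]_n :=
  match s with
  | 0%N => diag_block T 0
  | s'.+1 => diag_block T s'.+1
             - subdiag_block s' *m (invmx (Qblock T s') *m (subdiag_block s')^T)
  end.

Definition Ublock (T s : nat) : 'M[R]_n :=
  invmx (Qblock T s) *m (subdiag_block s)^T.

Fixpoint vblock (T s : nat) : 'cV[R]_n :=
  match s with
  | 0%N => invmx (Qblock T 0) *m rhs_block T 0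
  | s'.+1 => invmx (Qblock T s'.+1)
             *m (rhs_block T s'.+1 - subdiag_block s' *m vblock T s')
  end.

(* [backsub T k] is the value given to frame [T - k] by the [k]-th step of the
   backward substitution at time [T] (meaningful for [k <= T]). *)
Fixpoint backsub (T k : nat) : 'cV[R]_n :=
  match k with
  | 0%N => vblock T T
  | k'.+1 => vblock T (T - k'.+1) - Ublock T (T - k'.+1) *m backsub T k'
  end.

(* [trunc_sol b t T] is the value of frame [t] held at time [T >= t] with buffer
   size [b]: at time [T] the backward substitution runs through the frames
   T, T-1, ..., T-b only, and older frames keep the value they had at time T-1. *)
Fixpoint trunc_sol (b t T : nat) : 'cV[R]_n :=
  match T with
  | 0%N => backsub 0 0
  | T'.+1 => if (T'.+1 <= t + b)%N then backsub T'.+1 (T'.+1 - t)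
             else trunc_sol b t T'
  end.

Definition trunc_final (b t : nat) : 'cV[R]_n := trunc_sol b t (t + b).

End StreamingLeastSquares.

Definition stacked_norms (R : realType) (m : nat) (y : nat -> 'cV[R]_m) : set R :=
  range (fun t => enorm (col_mx (y t) (y t.+1))).

Definition eps_star (R : realType) (delta theta : R) : R :=
  (1 + delta) / 2 - Num.sqrt ((1 - delta) ^+ 2 / 4 - theta ^+ 2).

(* Main.v *)
(* Block LU elimination of the normal equations keeps every pivot [Q_s] within
   [eps] of the identity after scaling by [1 / kappa], because [eps] solves
   [delta + theta^2 / (1 - eps) = eps]; hence every [U_s] has norm at most
   [rho = theta / (1 - eps) < 1], and the forward and backward sweeps stay
   bounded by geometric series. Below the horizon the forward sweep does not
   depend on it, so two solutions with horizons [T <= T'] satisfy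
   [x_(s|T) - x_(s|T') = - U_s (x_(s+1|T) - x_(s+1|T'))] for [s < T]: their
   discrepancy at frame [t] is at most [rho^(T-t)] times a bounded quantity, and
   the solutions are Cauchy. The truncated value is the solution at horizon
   [t + b]. *)
Require Import Defs.
From HB Require Import structures.
From mathcomp Require Import all_boot all_order all_algebra.
From mathcomp Require Import ring lra.
From mathcomp Require Import all_classical all_reals all_analysis.

Set Implicit Arguments.
Unset Strict Implicit.
Unset Printing Implicit Defensive.

Import Order.TTheory GRing.Theory Num.Theory.
Import numFieldNormedType.Exports.

Local Open Scope classical_set_scope.
Local Open Scope ring_scope.

(** * Euclidean inner product and norm, and operator bounds *)

Section EuclideanNorm.
Context {R : realType}.

Definition dot k (x z : 'cV[R]_k) : R := (x^T *m z) 0 0.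

Lemma dotE k (x z : 'cV[R]_k) : dot x z = \sum_i x i 0 * z i 0.
Proof. by rewrite /dot mxE; apply: eq_bigr => i _; rewrite mxE. Qed.

Lemma dotC k (x z : 'cV[R]_k) : dot x z = dot z x.
Proof. by rewrite !dotE; apply: eq_bigr => i _; rewrite mulrC. Qed.

Lemma dotDr k (x z w : 'cV[R]_k) : dot x (z + w) = dot x z + dot x w.
Proof. by rewrite /dot mulmxDr mxE. Qed.

Lemma dotZr k (x z : 'cV[R]_k) a : dot x (a *: z) = a * dot x z.
Proof. by rewrite /dot -scalemxAr mxE. Qed.

Lemma dot0r k (x : 'cV[R]_k) : dot x 0 = 0.
Proof. by rewrite /dot mulmx0 mxE. Qed.

Lemma dotDl k (x z w : 'cV[R]_k) : dot (z + w) x = dot z x + dot w x.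
Proof. by rewrite dotC dotDr !(dotC x). Qed.

Lemma dotZl k (x z : 'cV[R]_k) a : dot (a *: z) x = a * dot z x.
Proof. by rewrite dotC dotZr (dotC x). Qed.

Lemma dot0l k (x : 'cV[R]_k) : dot 0 x = 0.
Proof. by rewrite dotC dot0r. Qed.

Lemma dot_mulmxr k l (M : 'M[R]_(k, l)) x z : dot x (M *m z) = dot (M^T *m x) z.
Proof. by rewrite /dot trmx_mul trmxK mulmxA. Qed.

Lemma dotxx_ge0 k (x : 'cV[R]_k) : 0 <= dot x x.
Proof. by rewrite dotE sumr_ge0 // => i _; rewrite -expr2 sqr_ge0. Qed.

Lemma enormE k (x : 'cV[R]_k) : enorm x = Num.sqrt (dot x x).
Proof. by rewrite /enorm dotE; congr Num.sqrt; apply: eq_bigr => i _; rewrite expr2. Qed.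

Lemma enorm_ge0 k (x : 'cV[R]_k) : 0 <= enorm x.
Proof. by rewrite enormE sqrtr_ge0. Qed.

Lemma sqr_enorm k (x : 'cV[R]_k) : enorm x ^+ 2 = dot x x.
Proof. by rewrite enormE sqr_sqrtr // dotxx_ge0. Qed.

Lemma le_enorm k (x : 'cV[R]_k) c : 0 <= c -> dot x x <= c ^+ 2 -> enorm x <= c.
Proof. by move=> c0; rewrite -sqr_enorm ler_pXn2r // nnegrE ?enorm_ge0. Qed.

Lemma dotxx_eq0 k (x : 'cV[R]_k) : dot x x = 0 -> x = 0.
Proof.
rewrite dotE => /eqP; rewrite psumr_eq0; last by move=> i _; rewrite -expr2 sqr_ge0.
move=> /allP x0; apply/matrixP => i j; rewrite ord1 mxE.
by apply/eqP; have := x0 i (mem_index_enum i); rewrite mulf_eq0 orbb.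
Qed.

Lemma enorm0 k : enorm (0 : 'cV[R]_k) = 0.
Proof. by rewrite enormE dot0r sqrtr0. Qed.

Lemma enorm_eq0 k (x : 'cV[R]_k) : enorm x = 0 -> x = 0.
Proof. by move=> x0; apply: dotxx_eq0; rewrite -sqr_enorm x0 expr0n. Qed.

Lemma enormZ k (x : 'cV[R]_k) a : enorm (a *: x) = `|a| * enorm x.
Proof. by rewrite !enormE dotZl dotZr mulrA -expr2 sqrtrM ?sqr_ge0// sqrtr_sqr. Qed.

Lemma enormN k (x : 'cV[R]_k) : enorm (- x) = enorm x.
Proof. by rewrite -scaleN1r enormZ normrN1 mul1r. Qed.

Lemma enorm_distC k (x z : 'cV[R]_k) : enorm (x - z) = enorm (z - x).
Proof. by rewrite -enormN opprB. Qed.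

(** Cauchy-Schwarz. With a, b the norms of [x], [z] and d their product, the vector
    [b *: x - a *: z] has squared norm 2ab(ab - d); its nonnegativity gives d <= ab once a and b are
    positive. *)
Lemma dot_le_enorm k (x z : 'cV[R]_k) : dot x z <= enorm x * enorm z.
Proof.
have [z0|zn0] := eqVneq (enorm z) 0.
  by rewrite (enorm_eq0 z0) dot0r enorm0 mulr0.
have [x0|xn0] := eqVneq (enorm x) 0.
  by rewrite (enorm_eq0 x0) dot0l enorm0 mul0r.
have xpos : 0 < enorm x by rewrite lt_neqAle eq_sym xn0 enorm_ge0.
have zpos : 0 < enorm z by rewrite lt_neqAle eq_sym zn0 enorm_ge0.
have := dotxx_ge0 (enorm z *: x + - enorm x *: z).
rewrite !(dotDl, dotDr, dotZl, dotZr) -!sqr_enorm (dotC z x).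
move: (enorm x) (enorm z) (dot x z) xpos zpos => a b d apos bpos h.
by rewrite -(ler_pM2l (mulr_gt0 apos bpos)); nra.
Qed.

Lemma enormD k (x z : 'cV[R]_k) : enorm (x + z) <= enorm x + enorm z.
Proof.
apply: le_enorm; first by rewrite addr_ge0 ?enorm_ge0.
rewrite !(dotDl, dotDr) (dotC z x) -!sqr_enorm.
have := dot_le_enorm x z; nra.
Qed.

Lemma enormB k (x z : 'cV[R]_k) : enorm (x - z) <= enorm x + enorm z.
Proof. by rewrite (le_trans (enormD _ _))// enormN. Qed.

(** Together with [enorm_le_normr], this carries Cauchy sequences and limits between [enorm] and the
    sup norm that governs the topology. *)
Lemma normr_le_enorm k (x : 'cV[R]_k) : `|x| <= enorm x.
Proof.
rewrite /Num.norm /= mx_normrE; apply/bigmax_leP; split; first exact: enorm_ge0.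
move=> [i j] _ /=; rewrite ord1 -sqrtr_sqr ler_wsqrtr//.
by rewrite (bigD1 i) //= lerDl sumr_ge0 // => l _; rewrite sqr_ge0.
Qed.

Lemma enorm_le_normr k (x : 'cV[R]_k) : enorm x <= k%:R * `|x|.
Proof.
have entry i : `|x i 0| <= `|x|.
  rewrite [leRHS]/Num.norm /= mx_normrE.
  exact: (le_bigmax _ (fun ij => `|x ij.1 ij.2|) (i, 0)).
apply: le_enorm; first by rewrite mulr_ge0.
rewrite dotE (@le_trans _ _ (\sum_(i < k) `|x| ^+ 2))//.
  by apply: ler_sum => i _; rewrite -expr2 -real_normK ?num_real// ler_pXn2r ?nnegrE.
rewrite sumr_const card_ord exprMn -[leLHS]mulr_natl ler_wpM2r ?sqr_ge0//.
by rewrite -natrX ler_nat; case: (k) => // k'; rewrite expnS leq_pmulr // expn_gt0.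
Qed.

(** Pointwise bounds combine under sums and products with no supremum to handle; [op_bounded_opnorm]
    links them to [opnorm]. *)
Definition op_bounded k l (M : 'M[R]_(k, l)) (c : R) :=
  forall x, enorm (M *m x) <= c * enorm x.

Lemma op_boundedD k l (M N : 'M[R]_(k, l)) c d :
  op_bounded M c -> op_bounded N d -> op_bounded (M + N) (c + d).
Proof.
move=> hM hN x; rewrite mulmxDl mulrDl (le_trans (enormD _ _))//.
by rewrite lerD.
Qed.

Lemma op_boundedZ k l (M : 'M[R]_(k, l)) c a :
  op_bounded M c -> op_bounded (a *: M) (`|a| * c).
Proof. by move=> hM x; rewrite -scalemxAl enormZ -mulrA ler_wpM2l. Qed.

Lemma op_boundedM k l p (M : 'M[R]_(k, l)) (N : 'M[R]_(l, p)) c d :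
  0 <= c -> op_bounded M c -> op_bounded N d -> op_bounded (M *m N) (c * d).
Proof.
move=> c0 hM hN x; rewrite -mulmxA (le_trans (hM _))// -mulrA.
by rewrite ler_wpM2l.
Qed.

Lemma op_bounded_le k l (M : 'M[R]_(k, l)) c d :
  c <= d -> op_bounded M c -> op_bounded M d.
Proof. by move=> cd hM x; rewrite (le_trans (hM x))// ler_wpM2r// enorm_ge0. Qed.

(** The square of [enorm (M^T *m x)] is the product of [x] with [M *m (M^T *m x)], hence at most
    [enorm x * (c * enorm (M^T *m x))]; one factor cancels. *)
Lemma op_bounded_tr k l (M : 'M[R]_(k, l)) c :
  0 <= c -> op_bounded M c -> op_bounded M^T c.
Proof.
move=> c0 hM x.
have [->|Mx0] := eqVneq (enorm (M^T *m x)) 0; first by rewrite mulr_ge0 ?enorm_ge0.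
have pos : 0 < enorm (M^T *m x) by rewrite lt_neqAle eq_sym Mx0 enorm_ge0.
rewrite -(ler_pM2l pos) -expr2 sqr_enorm -dot_mulmxr.
apply: le_trans (dot_le_enorm _ _) _.
have -> : enorm (M^T *m x) * (c * enorm x) = enorm x * (c * enorm (M^T *m x)) by ring.
by rewrite ler_wpM2l ?enorm_ge0.
Qed.

(** Ensures that the set defining [opnorm] is bounded above, so that its [sup] is a genuine
    supremum. *)
Lemma op_bounded_exists k l (M : 'M[R]_(k, l)) : exists c, op_bounded M c.
Proof.
pose s := \sum_i \sum_j `|M i j|.
have s0 : 0 <= s by rewrite sumr_ge0 // => i _; rewrite sumr_ge0.
exists (k%:R * s) => x; rewrite (le_trans (enorm_le_normr _))// -mulrA ler_wpM2l//.
rewrite {1}/Num.norm /= mx_normrE; apply/bigmax_leP; split.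
  by rewrite mulr_ge0 ?enorm_ge0.
move=> [i j] _ /=; rewrite ord1 mxE (le_trans (ler_norm_sum _ _ _))//.
rewrite /s mulr_suml (bigD1 i) //= mulr_suml ler_wpDr//.
  by rewrite sumr_ge0 // => i' _; rewrite mulr_ge0 ?enorm_ge0// sumr_ge0.
apply: ler_sum => p _; rewrite normrM ler_wpM2l // -sqrtr_sqr ler_wsqrtr//.
by rewrite (bigD1 p) //= lerDl sumr_ge0 // => q _; rewrite sqr_ge0.
Qed.

Lemma op_bounded_opnorm k l (M : 'M[R]_(k, l)) : op_bounded M (opnorm M).
Proof.
have [c hc] := op_bounded_exists M.
have ub x : enorm x <= 1 -> enorm (M *m x) <= opnorm M.
  move=> x1; apply: ub_le_sup; last by exists x.
  exists `|c| => _ [z /= z1 <-]; rewrite (le_trans (hc z))//.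
  by rewrite (le_trans (ler_wpM2r (enorm_ge0 _) (ler_norm c)))// ler_piMr.
move=> x; have [x0|xn0] := eqVneq (enorm x) 0.
  by rewrite (enorm_eq0 x0) mulmx0 !enorm0 mulr0.
have xpos : 0 < enorm x by rewrite lt_neqAle eq_sym xn0 enorm_ge0.
have := ub ((enorm x)^-1 *: x); rewrite -scalemxAr !enormZ.
rewrite ger0_norm ?invr_ge0 ?enorm_ge0// mulVf // => /(_ (lexx _)).
by rewrite ler_pdivrMl // mulrC.
Qed.

Lemma opnorm_ge0 k l (M : 'M[R]_(k, l)) : 0 <= opnorm M.
Proof.
have [c hc] := op_bounded_exists M.
apply: ub_le_sup; last by exists 0; rewrite /= ?mulmx0 enorm0.
exists `|c| => _ [z /= z1 <-]; rewrite (le_trans (hc z))//.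
by rewrite (le_trans (ler_wpM2r (enorm_ge0 _) (ler_norm c)))// ler_piMr.
Qed.

(** A kernel vector [u] of [Q] satisfies [enorm u <= e * enorm u], so it vanishes because
    [e < 1]. *)
Lemma unitmx_near_scalar k (Q : 'M[R]_k) a e :
  e < 1 -> op_bounded (a *: Q - 1%:M) e -> Q \in unitmx.
Proof.
move=> e1 hQ; rewrite -unitmx_tr -row_free_unit -kermx_eq0.
apply/eqP/row_matrixP => i; rewrite row0.
set u := row i _.
have Qu : Q *m u^T = 0.
  have : u *m Q^T = 0 by apply/sub_kermxP; rewrite row_sub.
  by move=> /(congr1 trmx); rewrite trmx_mul trmxK trmx0.
have := hQ u^T; rewrite mulmxBl -scalemxAl Qu scaler0 sub0r mul1mx enormN.
move=> h; have /enorm_eq0 /(congr1 trmx) : enorm u^T = 0.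
  by apply/eqP; rewrite eq_le enorm_ge0 andbT; have := enorm_ge0 u^T; nra.
by rewrite trmxK trmx0.
Qed.

(** A Neumann-type bound: w = [invmx Q *m x] equals [a^-1 *: x] minus the image of w under
    [a^-1 *: Q - 1%:M], so [1 - e] times its norm is at most [a^-1 * enorm x]. *)
Lemma op_bounded_inv k (Q : 'M[R]_k) a e :
  0 < a -> e < 1 -> op_bounded (a^-1 *: Q - 1%:M) e ->
  op_bounded (invmx Q) (a^-1 / (1 - e)).
Proof.
move=> a0 e1 hQ x.
have Qu := unitmx_near_scalar e1 hQ.
have := hQ (invmx Q *m x).
rewrite mulmxBl mul1mx -scalemxAl mulKVmx // => h.
have tri : enorm (invmx Q *m x) <= a^-1 * enorm x + e * enorm (invmx Q *m x).
  have := enormB (a^-1 *: x) (a^-1 *: x - invmx Q *m x).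
  rewrite subKr enormZ (ger0_norm (ltW _)) ?invr_gt0// => /le_trans; apply.
  by rewrite lerD2l.
rewrite mulrAC ler_pdivlMr ?subr_gt0//.
by rewrite mulrBr mulr1 lerBlDr [X in _ + X]mulrC.
Qed.

End EuclideanNorm.

(** At [a = - l / (q + 1)] the quadratic equals [- (l / (q + 1)) ^+ 2]; using [q + 1] instead of [q]
    covers [q = 0]. *)
Lemma eq0_of_quadratic_ge0 (R : realFieldType) (l q : R) :
  0 <= q -> (forall a, 0 <= a * l + a ^+ 2 * q) -> l = 0.
Proof.
move=> q0 /(_ (- l / (q + 1))).
have q1 : 0 < q + 1 by lra.
have -> : - l / (q + 1) * l + (- l / (q + 1)) ^+ 2 * q = - (l / (q + 1)) ^+ 2.
  by field; rewrite gt_eqF.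
rewrite oppr_ge0 => h; have : l / (q + 1) == 0.
  by rewrite -sqrf_eq0 eq_le h sqr_ge0.
by rewrite mulf_eq0 invr_eq0 (gt_eqF q1) orbF => /eqP.
Qed.

(** * Normal equations and correctness of the block LU solver *)

Section NormalEquations.
Context {R : realType} {m n : nat}.
Context (A B : nat -> 'M[R]_(m, n)) (y : nat -> 'cV[R]_m) (gamma : R).

Local Notation H := (diag_block A B gamma).
Local Notation E := (subdiag_block A B).
Local Notation g := (rhs_block A B y).
Local Notation Q := (Qblock A B gamma).
Local Notation U := (Ublock A B gamma).
Local Notation v := (vblock A B y gamma).

(* Setting [B 0] to zero makes the [t = 0] term of the objective an instance of
   the generic one. *)
Definition coupling (t : nat) : 'M[R]_(m, n) := if t is 0%N then 0 else B t.

Definition frame_map (x : nat -> 'cV[R]_n) (t : nat) : 'cV[R]_m :=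
  coupling t *m x t.-1 + A t *m x t.

Definition residual (x : nat -> 'cV[R]_n) (t : nat) : 'cV[R]_m :=
  frame_map x t - y t.

Lemma ls_objectiveE T x :
  ls_objective A B y gamma T x =
  \sum_(0 <= t < T.+1) (dot (residual x t) (residual x t)
                        + gamma * dot (x t) (x t)).
Proof.
rewrite big_ltn // /ls_objective !sqr_enorm /residual /frame_map /= mul0mx add0r.
by congr (_ + _); apply: eq_big_nat => -[//|t] _; rewrite !sqr_enorm.
Qed.

(** Half the gradient of the objective in frame [t]: that frame enters residual [t] and, before the
    horizon, residual [t.+1]. *)
Definition gradient T (x : nat -> 'cV[R]_n) (t : nat) : 'cV[R]_n :=
  (A t)^T *m residual x t + gamma *: x t
  + (if (t < T)%N then (B t.+1)^T *m residual x t.+1 else 0).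

(** Summation by parts: moving the matrices to the other side of each product regroups the
    first-order term by frame instead of by residual. *)
Lemma sum_dot_gradient T x h :
  \sum_(0 <= t < T.+1) (dot (frame_map h t) (residual x t)
                        + gamma * dot (h t) (x t)) =
  \sum_(0 <= t < T.+1) dot (h t) (gradient T x t).
Proof.
rewrite /frame_map.
under eq_bigr do rewrite dotDl -addrA.
rewrite big_split /=.
rewrite /gradient.
under [RHS]eq_bigr do rewrite dotDr addrC.
rewrite [RHS]big_split /=; congr (_ + _); last first.
  apply: eq_bigr => t _.
  by rewrite [in RHS]dotDr dotZr [in RHS]dot_mulmxr trmxK.
(* The coupling vanishes at the first index and no residual follows the horizon, so both sums keep
   [T] terms, matched by a shift of one. *)
rewrite big_nat_recl // mul0mx dot0l add0r [RHS]big_nat_recr //= ltnn dot0r addr0.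
apply: eq_big_nat => t /andP[_ ->].
by rewrite dot_mulmxr trmxK.
Qed.

Lemma residual_shift x h a t :
  residual (fun t => x t + a *: h t) t = residual x t + a *: frame_map h t.
Proof.
rewrite /residual /frame_map !mulmxDr -!scalemxAr scalerDr.
by apply/matrixP => i j; rewrite !mxE; ring.
Qed.

Lemma ls_objective_shift T x h a :
  ls_objective A B y gamma T (fun t => x t + a *: h t) =
  ls_objective A B y gamma T x
  + (a * (2 * \sum_(0 <= t < T.+1) (dot (frame_map h t) (residual x t)
                                    + gamma * dot (h t) (x t)))
     + a ^+ 2 * \sum_(0 <= t < T.+1) (dot (frame_map h t) (frame_map h t)
                                      + gamma * dot (h t) (h t))).
Proof.
rewrite !ls_objectiveE !mulr_sumr -!big_split /=; apply: eq_bigr => i _.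
rewrite residual_shift.
move: (residual x i) (frame_map h i) (x i) (h i) => r f p d.
rewrite !(dotDl, dotDr, dotZl, dotZr) (dotC r) (dotC p d).
by ring.
Qed.

Lemma gradient_minimizer T x :
  0 <= gamma -> is_ls_minimizer A B y gamma T x ->
  forall t, (t <= T)%N -> gradient T x t = 0.
Proof.
move=> gamma0 xmin t tT.
(* Moving along the gradient itself, the first-order term of the objective is
   the sum of the squared norms of the blocks of the gradient. *)
pose h := gradient T x.
pose q := \sum_(0 <= t < T.+1) (dot (frame_map h t) (frame_map h t)
                                + gamma * dot (h t) (h t)).
have q0 : 0 <= q.
  by rewrite sumr_ge0 // => i _; rewrite addr_ge0 ?dotxx_ge0 ?mulr_ge0 ?dotxx_ge0.
pose l := \sum_(0 <= t < T.+1) dot (h t) (h t).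
have fE a := ls_objective_shift T x h a.
rewrite sum_dot_gradient -/l -/q in fE.
have l0 : 2 * l = 0.
  apply: (eq0_of_quadratic_ge0 q0) => a.
  by have := xmin (fun t => x t + a *: h t); rewrite fE lerDl.
move/eqP: l0; rewrite mulf_eq0 pnatr_eq0 /= => l0.
move: l0; rewrite /l psumr_eq0 => [/allP l0|i _]; last exact: dotxx_ge0.
apply: dotxx_eq0; apply/eqP; apply: (implyP (l0 t _)) => //.
by rewrite mem_index_iota.
Qed.

(** This is the vanishing of [gradient] with the data terms moved to the right; the conditionals
    drop the missing neighbours at the two ends. *)
Lemma normal_equations T x :
  0 <= gamma -> is_ls_minimizer A B y gamma T x ->
  forall s, (s <= T)%N ->
  (if s is s'.+1 then E s' *m x s' else 0) + H T s *m x s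
  + (if (s < T)%N then (E s)^T *m x s.+1 else 0) = g T s.
Proof.
move=> gamma0 xmin s sT; apply/eqP; rewrite -subr_eq0; apply/eqP.
rewrite -[RHS](gradient_minimizer gamma0 xmin sT).
rewrite /gradient /residual /frame_map /rhs_block /diag_block /subdiag_block.
have -> : (if s is s'.+1 then (A s'.+1)^T *m B s'.+1 *m x s' else 0)
    = (A s)^T *m (coupling s *m x s.-1).
  by case: s {sT} => [|s] /=; rewrite ?mul0mx ?mulmx0 ?mulmxA.
case: ifP => _; last first.
  rewrite !mulmxDr mulmxDl mul_scalar_mx mulmxN !addr0 -!mulmxA -!addrA.
  by congr (_ + (_ + _)); rewrite addrC.
rewrite !(mulmxDr, mulmxDl) mul_scalar_mx !mulmxN trmx_mul trmxK -!mulmxA /=.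
set p1 := _ *m (coupling s *m _); set p2 := (A s)^T *m (A s *m _).
set p3 := _ *m (B s.+1 *m _); set p4 := gamma *: _; set p5 := _ *m (A s.+1 *m _).
by apply/matrixP => i j; rewrite !mxE; ring.
Qed.

Context (Q_unit : forall T s, (s <= T)%N -> Q T s \in unitmx).

(** Block elimination: substituting the identity for the previous frame into row [s] removes that
    frame and turns the diagonal block into the pivot [Q T s]. *)
Lemma forward_sweep T x :
  0 <= gamma -> is_ls_minimizer A B y gamma T x ->
  forall s, (s <= T)%N ->
  x s + (if (s < T)%N then U T s *m x s.+1 else 0) = v T s.
Proof.
move=> gamma0 xmin.
have step s w : (s <= T)%N ->
    Q T s *m x s + (if (s < T)%N then (E s)^T *m x s.+1 else 0) = w ->
    x s + (if (s < T)%N then U T s *m x s.+1 else 0) = invmx (Q T s) *m w.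
  move=> sT <-; rewrite mulmxDr mulKmx ?Q_unit //; congr (_ + _).
  by rewrite /Ublock -mulmxA; case: ifP => _; rewrite ?mulmx0.
elim=> [|s IH] sT.
  by apply: step => //; rewrite -(normal_equations gamma0 xmin sT) /= add0r.
apply: step => //; rewrite -(normal_equations gamma0 xmin sT) /=.
(* Once [v T s] is expanded as [x s + U T s *m x s.+1], the term in [E s *m U T s] is exactly the
   correction that defines [Q T s.+1]. *)
rewrite -[X in _ = _ - _ *m X]/(v T s) -(IH (ltnW sT)) sT.
rewrite mulmxBl mulmxDr /Ublock !mulmxA.
set c := if _ then _ else _.
by apply/matrixP => i j; rewrite !mxE; ring.
Qed.

(** Solving the identity of [forward_sweep] for [x s] is one step of the backward substitution, with
    frames counted back from the horizon. *)
Lemma backsub_minimizer T x :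
  0 <= gamma -> is_ls_minimizer A B y gamma T x ->
  forall k, (k <= T)%N -> backsub A B y gamma T k = x (T - k)%N.
Proof.
move=> gamma0 xmin; elim=> [|k IH] kT /=.
  by rewrite subn0 -(forward_sweep gamma0 xmin (leqnn T)) ltnn addr0.
rewrite IH 1?ltnW // -(forward_sweep gamma0 xmin (leq_subr _ _)).
by rewrite ltn_subrL /= (leq_trans _ kT) // subnSK // addrK.
Qed.

(** The strict inequalities matter: at the horizon itself the diagonal block lacks its [B] term. *)
Lemma diag_block_horizon T T' s :
  (s < T)%N -> (s < T')%N -> H T s = H T' s.
Proof. by rewrite /diag_block => -> ->. Qed.

Lemma Qblock_horizon T T' s : (s < T)%N -> (s < T')%N -> Q T s = Q T' s.
Proof.
elim: s => [|s IH] sT sT' /=; first exact: diag_block_horizon.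
by rewrite (diag_block_horizon sT sT') IH // ltnW.
Qed.

Lemma Ublock_horizon T T' s : (s < T)%N -> (s < T')%N -> U T s = U T' s.
Proof. by move=> sT sT'; rewrite /Ublock (Qblock_horizon sT sT'). Qed.

Lemma vblock_horizon T T' s : (s < T)%N -> (s < T')%N -> v T s = v T' s.
Proof.
elim: s => [|s IH] sT sT'.
  by rewrite /= (diag_block_horizon sT sT') /rhs_block sT sT'.
rewrite /vblock -/(v T s) -/(v T' s) (Qblock_horizon sT sT') IH 1?ltnW //.
by rewrite /rhs_block sT sT'.
Qed.

End NormalEquations.

(** * Geometric convergence, scalar fixed points and the truncated value *)

Lemma cvg_of_geometric_cauchy (R : realType) k (u : nat -> 'cV[R]_k) (c r : R) :
  0 <= r < 1 ->
  (forall i j, (i <= j)%N -> enorm (u i - u j) <= c * r ^+ i) ->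
  exists2 l : 'cV[R]_k, u i @[i --> \oo] --> l & forall i, enorm (u i - l) <= c * r ^+ i.
Proof.
move=> /andP[r0 r1] hu.
have e0 : (c * r ^+ i) @[i --> \oo] --> (0 : R).
  by apply: cvg_geometric; rewrite ger0_norm.
have ul : cvg (u i @[i --> \oo]).
  apply/cauchy_cvgP/cauchy_exP => e epos.
  have [N _ hN] := (cvgr0Pnorm_lt _).1 e0 e epos.
  exists (u N), N => // i /= Ni; rewrite -ball_normE /ball_ /=.
  rewrite (le_lt_trans (normr_le_enorm _))// (le_lt_trans (hu _ _ Ni))//.
  by rewrite (le_lt_trans (ler_norm _))//; apply: hN => /=.
exists (lim (u i @[i --> \oo])); first exact: ul.
set l := lim _ => i; apply/ler_addgt0Pr => e epos.
(* Dividing by [k%:R + 1] absorbs the factor [k] of [enorm_le_normr] and remains legitimate for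
   [k = 0]. *)
have k1 : 0 < k%:R + 1 :> R by rewrite ltr_wpDl.
have [N _ hN] := (cvgrPdist_lt _ _).1 ul (e / (k%:R + 1)) (divr_gt0 epos k1).
pose j := maxn i N.
have -> : u i - l = (u i - u j) + (u j - l) by rewrite addrA subrK.
apply: le_trans (enormD _ _) _; apply: lerD; first by apply: hu; exact: leq_maxl.
rewrite enorm_distC (le_trans (enorm_le_normr _))//.
have := hN j (leq_maxr _ _); rewrite /= -/l ltr_pdivlMr// => h.
by rewrite (le_trans _ (ltW h))// mulrC ler_wpM2l// lerDl.
Qed.

(** [eps] is the smaller root of [(e - delta) * (1 - e) = theta ^+ 2]: with [r] the square root, the
    factors are [(1 - delta) / 2 - r] and [(1 - delta) / 2 + r]. *)
Lemma eps_star_fixpoint (R : realType) (delta theta : R) :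
  theta ^+ 2 <= (1 - delta) ^+ 2 / 4 -> delta < 1 ->
  let eps := eps_star delta theta in
  [/\ delta <= eps, eps < 1 & delta + theta ^+ 2 / (1 - eps) = eps].
Proof.
move=> th d1 eps.
set r := Num.sqrt ((1 - delta) ^+ 2 / 4 - theta ^+ 2).
have r0 : 0 <= r by rewrite sqrtr_ge0.
have r2 : r ^+ 2 = (1 - delta) ^+ 2 / 4 - theta ^+ 2 by rewrite sqr_sqrtr ?subr_ge0.
have epsE : eps = (1 + delta) / 2 - r by [].
have th0 := sqr_ge0 theta.
have e1 : eps < 1 by rewrite epsE; lra.
split => //; first by rewrite epsE; nra.
have -> : theta ^+ 2 = (eps - delta) * (1 - eps).
  have -> : theta ^+ 2 = (1 - delta) ^+ 2 / 4 - r ^+ 2 by rewrite r2; ring.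
  by rewrite epsE; field.
by rewrite mulfK ?subrKC // subr_eq0 gt_eqF.
Qed.

(** For [0 <= r], a recurrence [a' <= w + r * a] therefore preserves the bound [w / (1 - r)], the
    sum of the geometric series. *)
Lemma geometric_fixpoint (R : realFieldType) (w r : R) :
  r < 1 -> w + r * (w / (1 - r)) = w / (1 - r).
Proof. by move=> r1; field; rewrite gt_eqF // subr_gt0. Qed.

(** Time [t + b] is the last one at which frame [t] is still refreshed, by step [b] of the backward
    substitution. *)
Lemma trunc_finalE (R : realType) m n (A B : nat -> 'M[R]_(m, n)) y gamma b t :
  trunc_final A B y gamma b t = backsub A B y gamma (t + b) b.
Proof.
rewrite /trunc_final; case E : (t + b)%N => [|T].
  by have -> : b = 0%N by move/eqP: E; rewrite addn_eq0 => /andP[_ /eqP].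
by rewrite /trunc_sol E leqnn -E addKn.
Qed.

(** * Uniform bounds on the pivots and on the forward sweep *)

Section Bounds.
Context {R : realType} {m n : nat}.
Context (A B : nat -> 'M[R]_(m, n)) (y : nat -> 'cV[R]_m).
Context (gamma kappa delta theta My : R).

Local Notation H := (diag_block A B gamma).
Local Notation E := (subdiag_block A B).
Local Notation g := (rhs_block A B y).
Local Notation Q := (Qblock A B gamma).
Local Notation U := (Ublock A B gamma).
Local Notation v := (vblock A B y gamma).
Local Notation eps := (eps_star delta theta).
Local Notation rho := (theta / (1 - eps)).

Context (gamma0 : 0 <= gamma) (kappa1 : 1 <= kappa).
Context (theta0 : 0 <= theta) (delta0 : 0 <= delta) (delta1 : delta < 1).
Context (theta_le : theta <= (1 - delta) / 2) (theta_lt : theta < 1 - eps).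
Context (H_near : forall T t, (t <= T)%N ->
  op_bounded (kappa^-1 *: H T t - 1%:M) delta).
Context (E_bounded : forall t, op_bounded (E t) (kappa * theta)).
Context (y_bounded : forall t, enorm (col_mx (y t) (y t.+1)) <= My).

Let kappa0 : 0 < kappa. Proof. exact: lt_le_trans ltr01 kappa1. Qed.

Let kappaV0 : 0 < kappa^-1. Proof. by rewrite invr_gt0. Qed.

Let epsP : [/\ delta <= eps, eps < 1 & delta + theta ^+ 2 / (1 - eps) = eps].
Proof.
apply: eps_star_fixpoint => //.
have -> : (1 - delta) ^+ 2 / 4 = ((1 - delta) / 2) ^+ 2 by field.
by rewrite ler_pXn2r // nnegrE (le_trans theta0).
Qed.

Let eps1 : 0 < 1 - eps. Proof. by rewrite subr_gt0; case: epsP. Qed.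

Lemma rho_ge0 : 0 <= rho. Proof. by rewrite divr_ge0 // ltW. Qed.

Lemma rho_lt1 : rho < 1. Proof. by rewrite ltr_pdivrMr // mul1r. Qed.

Let E_coef_ge0 : 0 <= kappa * theta. Proof. by rewrite mulr_ge0 // ltW. Qed.

(* [eps] is the fixed point of the map giving the distance to the identity
   after one elimination step. *)
Lemma Qblock_near T s : (s <= T)%N -> op_bounded (kappa^-1 *: Q T s - 1%:M) eps.
Proof.
have [de e1 fixE] := epsP.
elim: s => [|s IH] sT; first exact: op_bounded_le de (H_near sT).
have Qinv := op_bounded_inv kappa0 e1 (IH (ltnW sT)).
rewrite /= scalerBr addrAC -fixE; apply: op_boundedD; first exact: H_near.
rewrite -scaleNr.
(* The factors bound the scaling, [E s], the inverse pivot and the transpose of [E s]; the powers of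
   [kappa] cancel. *)
have -> : theta ^+ 2 / (1 - eps)
    = `|- kappa^-1| * (kappa * theta * (kappa^-1 / (1 - eps) * (kappa * theta))).
  rewrite normrN gtr0_norm //; field.
  by rewrite !gt_eqF.
apply: op_boundedZ; apply: op_boundedM => //; apply: op_boundedM => //.
  by rewrite divr_ge0 ?ltW.
exact: op_bounded_tr.
Qed.

Lemma Qblock_unit T s : (s <= T)%N -> Q T s \in unitmx.
Proof.
by move=> sT; have [_ e1 _] := epsP; exact: unitmx_near_scalar e1 (Qblock_near sT).
Qed.

Lemma Qblock_inv_bounded T s :
  (s <= T)%N -> op_bounded (invmx (Q T s)) (kappa^-1 / (1 - eps)).
Proof.
by move=> sT; have [_ e1 _] := epsP; exact: op_bounded_inv (Qblock_near sT).
Qed.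

Let Qinv_coef_ge0 : 0 <= kappa^-1 / (1 - eps).
Proof. by rewrite divr_ge0 ?ltW. Qed.

Lemma Ublock_bounded T s : (s <= T)%N -> op_bounded (U T s) rho.
Proof.
move=> sT; have -> : rho = kappa^-1 / (1 - eps) * (kappa * theta).
  by field; rewrite !gt_eqF.
apply: op_boundedM => //; first exact: Qblock_inv_bounded.
exact: op_bounded_tr.
Qed.

(** Stacking the two blocks of column [s] into [K] gives [g T s] as [K^T] applied to stacked data,
    while [K^T *m K + gamma%:M] is [H T s]; the bound on [H T s] thus controls [K]. *)
Lemma rhs_block_bounded T s :
  (s <= T)%N -> enorm (g T s) <= kappa * (Num.sqrt (1 + delta) * My).
Proof.
move=> sT.
(* At the horizon the zero lower block discards [y s.+1]. *)
pose K := col_mx (A s) (if (s < T)%N then B s.+1 else 0).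
have gE : g T s = K^T *m col_mx (y s) (y s.+1).
  rewrite /rhs_block /K tr_col_mx mul_row_col.
  by case: ifP => _; rewrite ?trmx0 ?mul0mx ?addr0.
have HE : H T s = K^T *m K + gamma%:M.
  rewrite /diag_block /K tr_col_mx mul_row_col.
  by case: ifP => _; rewrite ?trmx0 ?mul0mx ?addr0.
have d1 : 0 <= 1 + delta by rewrite addr_ge0.
have H_bounded : op_bounded (H T s) (kappa * (1 + delta)).
  have -> : H T s = kappa *: ((kappa^-1 *: H T s - 1%:M) + 1%:M).
    by rewrite subrK scalerA divff ?scale1r // gt_eqF.
  rewrite -[X in X * _](gtr0_norm kappa0); apply: op_boundedZ.
  rewrite [1 + delta]addrC; apply: op_boundedD (H_near sT) _ => x.
  by rewrite mul1mx mul1r.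
(* The square root of [kappa] is relaxed to [kappa], by [1 <= kappa], so that it cancels the
   [kappa^-1] of the inverse pivot and the final constant is free of [kappa]. *)
have K_bounded : op_bounded K (kappa * Num.sqrt (1 + delta)).
  move=> x; apply: le_enorm; first by rewrite !mulr_ge0 ?enorm_ge0 ?sqrtr_ge0 // ltW.
  rewrite !exprMn sqr_sqrtr //.
  apply: (@le_trans _ _ (dot x (H T s *m x))).
    rewrite HE mulmxDl dotDr mul_scalar_mx dotZr -mulmxA.
    by rewrite [dot x (_^T *m _)]dot_mulmxr trmxK lerDl mulr_ge0 ?dotxx_ge0.
  apply: le_trans (dot_le_enorm _ _) _.
  apply: le_trans (ler_wpM2l (enorm_ge0 _) (H_bounded x)) _.
  have -> : enorm x * (kappa * (1 + delta) * enorm x)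
      = kappa * ((1 + delta) * enorm x ^+ 2) by ring.
  rewrite -[leRHS]mulrA ler_wpM2r // ?(mulr_ge0 d1 (sqr_ge0 _)) //.
  by rewrite expr2 ler_peMr // ltW.
rewrite gE mulrA.
have c0 : 0 <= kappa * Num.sqrt (1 + delta) by rewrite mulr_ge0 ?sqrtr_ge0 ?ltW.
apply: le_trans (op_bounded_tr c0 K_bounded _) _.
by rewrite ler_wpM2l.
Qed.

Let W := Num.sqrt (1 + delta) * My / (1 - eps).

Let rho1 : 0 < 1 - rho. Proof. by rewrite subr_gt0 rho_lt1. Qed.

Let W_ge0 : 0 <= W.
Proof.
apply: divr_ge0; last exact: ltW.
rewrite mulr_ge0 ?sqrtr_ge0 //.
exact: le_trans (enorm_ge0 _) (y_bounded 0).
Qed.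

Let V := W / (1 - rho).

Let V_ge0 : 0 <= V. Proof. by rewrite divr_ge0 // ltW. Qed.

Let VE : W + rho * V = V.
Proof. exact: geometric_fixpoint rho_lt1. Qed.

(** Each step satisfies [enorm (v T s.+1) <= W + rho * enorm (v T s)], and [V] is the fixed point of
    this recurrence. *)
Lemma vblock_bounded T s : (s <= T)%N -> enorm (v T s) <= V.
Proof.
have coef x : kappa^-1 / (1 - eps) * (kappa * x) = x / (1 - eps).
  by field; rewrite !gt_eqF.
elim: s => [|s IH] sT /=.
  apply: le_trans (Qblock_inv_bounded sT _) _.
  apply: le_trans (ler_wpM2l Qinv_coef_ge0 (rhs_block_bounded sT)) _.
  by rewrite coef -/W -VE lerDl mulr_ge0 // rho_ge0.
apply: le_trans (Qblock_inv_bounded sT _) _.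
have h : enorm (g T s.+1 - E s *m v T s)
    <= kappa * (Num.sqrt (1 + delta) * My) + kappa * (theta * V).
  apply: le_trans (enormB _ _) _; apply: lerD; first exact: rhs_block_bounded.
  apply: le_trans (E_bounded _ _) _.
  by rewrite mulrA ler_wpM2l // IH // ltnW.
apply: le_trans (ler_wpM2l Qinv_coef_ge0 h) _.
by rewrite mulrDr !coef -/W mulrAC VE.
Qed.

(** * Bounds and convergence of the untruncated solutions *)

Section Solutions.
Context (xhat : nat -> nat -> 'cV[R]_n).
Context (xhat_min : forall T, is_ls_minimizer A B y gamma T (xhat^~ T)).

Let X := V / (1 - rho).

Let XE : V + rho * X = X.
Proof. exact: geometric_fixpoint rho_lt1. Qed.

Let sweep T s : (s <= T)%N ->
  xhat s T = v T s - (if (s < T)%N then U T s *m xhat s.+1 T else 0).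
Proof.
move=> sT; rewrite -(forward_sweep Qblock_unit gamma0 (xhat_min T) sT).
by rewrite addrK.
Qed.

(** Induction on the distance to the horizon: the backward recurrence adds at most [V] to [rho]
    times the next frame, and [X] is its fixed point. *)
Lemma minimizer_bounded T s : (s <= T)%N -> enorm (xhat s T) <= X.
Proof.
have X0 : 0 <= X by rewrite divr_ge0 // ltW.
move=> sT; rewrite -(subKn sT); elim: (T - s)%N (leq_subr s T) => [|k IH] kT.
  rewrite subn0 (sweep (leqnn T)) ltnn subr0 -XE.
  by rewrite (le_trans (vblock_bounded (leqnn T)))// lerDl mulr_ge0 // rho_ge0.
have lt : (T - k.+1 < T)%N by rewrite ltn_subrL /= (leq_trans _ kT).
rewrite (sweep (ltnW lt)) lt subnSK // -XE.
apply: le_trans (enormB _ _) _; apply: lerD; first exact: vblock_bounded (ltnW lt).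
apply: le_trans (Ublock_bounded (ltnW lt) _) _.
by rewrite ler_wpM2l ?rho_ge0 // IH // ltnW.
Qed.

(* The forward sweep below the horizon does not depend on the horizon, so the
   discrepancy between two horizons is contracted by each [U T s]. *)
Lemma minimizer_horizon_diff t T T' :
  (t <= T)%N -> (T <= T')%N ->
  enorm (xhat t T - xhat t T') <= 2 * X * rho ^+ (T - t).
Proof.
move=> tT TT'; rewrite -{1 2}(subKn tT).
elim: (T - t)%N (leq_subr t T) => [|k IH] kT.
  (* At frame [T] the two sweeps may differ, so only the uniform bound [X] on each solution applies;
     hence the factor 2. *)
  rewrite subn0 expr0 mulr1 mulr_natl mulr2n.
  by apply: le_trans (enormB _ _) _; apply: lerD; exact: minimizer_bounded.
have lt : (T - k.+1 < T)%N by rewrite ltn_subrL /= (leq_trans _ kT).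
have lt' := leq_trans lt TT'.
rewrite (sweep (ltnW lt)) (sweep (ltnW lt')) lt lt' subnSK //.
rewrite (vblock_horizon _ _ _ _ lt' lt) (Ublock_horizon _ _ _ lt' lt).
rewrite opprB addrC addrA subrK -mulmxBr.
apply: le_trans (Ublock_bounded (ltnW lt) _) _.
by rewrite exprS mulrCA ler_wpM2l ?rho_ge0 // enorm_distC IH // ltnW.
Qed.

(** The estimates hold only from time [t] on, so the Cauchy argument is run on the sequence shifted
    by [t]. *)
Lemma minimizer_converges t : exists2 xs : 'cV[R]_n,
  xhat t T @[T --> \oo] --> xs
  & forall T, (t <= T)%N -> enorm (xhat t T - xs) <= 2 * X * rho ^+ (T - t).
Proof.
have rho01 : 0 <= rho < 1 by rewrite rho_ge0 rho_lt1.
have cauchy i j : (i <= j)%N ->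
    enorm (xhat t (i + t) - xhat t (j + t)) <= 2 * X * rho ^+ i.
  move=> ij; rewrite -[in leRHS](addnK t i).
  by apply: minimizer_horizon_diff; rewrite ?leq_addl ?leq_add2r.
have [xs cv hxs] := cvg_of_geometric_cauchy rho01 cauchy.
exists xs => [|T tT]; last by have := hxs (T - t)%N; rewrite subnK.
by move: cv; rewrite (cvg_shiftn t (xhat t)).
Qed.

End Solutions.

End Bounds.

Theorem corollary1 (R : realType) :
  exists C : R -> R -> R -> R,
  forall (m n : nat) (A B : nat -> 'M[R]_(m, n)) (y : nat -> 'cV[R]_m)
    (gamma : R) (xhat : nat -> nat -> 'cV[R]_n) (kappa delta theta : R),
  0 <= gamma ->
  (forall T : nat, is_ls_minimizer A B y gamma T (xhat^~ T)) ->
  1 <= kappa ->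
  delta < 1 ->
  theta <= (1 - delta) / 2 ->
  (forall T t : nat, (t <= T)%N ->
     opnorm (kappa^-1 *: diag_block A B gamma T t - 1%:M) <= delta) ->
  (forall t : nat, opnorm (subdiag_block A B t) <= kappa * theta) ->
  theta < 1 - eps_star delta theta ->
  has_ubound (stacked_norms y) ->
  let eps := eps_star delta theta in
  let My := sup (stacked_norms y) in
  exists xstar : nat -> 'cV[R]_n,
    [/\ forall t : nat, xhat t T @[T --> \oo] --> xstar t,
        forall t T : nat, (t <= T)%N ->
          enorm (xhat t T - xstar t)
            <= C eps theta delta * My * (theta / (1 - eps)) ^+ (T - t)
      & forall b t T : nat, (t + b <= T)%N ->
          enorm (xstar t - trunc_final A B y gamma b t)
            <= C eps theta delta * My * (theta / (1 - eps)) ^+ b].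
Proof.
(* This is [2 * X] with [My] factored out: the two divisions by [1 - th / (1 - e)] come from the
   forward and backward geometric series. *)
exists (fun e th d =>
  2 * (Num.sqrt (1 + d) / (1 - e) / (1 - th / (1 - e)) / (1 - th / (1 - e)))).
move=> m n A B y gamma xhat kappa delta theta gamma0 xhat_min kappa1 delta1.
move=> theta_le H_op E_op theta_lt y_ub eps My.
have kappa0 : 0 < kappa by exact: lt_le_trans ltr01 kappa1.
(* Nonnegativity of [theta], and next of [delta], comes from the operator norms they dominate. *)
have theta0 : 0 <= theta.
  by rewrite -(pmulr_rge0 _ kappa0) (le_trans _ (E_op 0%N)) ?opnorm_ge0.
have delta0 : 0 <= delta by rewrite (le_trans _ (H_op 0%N 0%N _)) ?opnorm_ge0.
have H_near T t : (t <= T)%N ->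
    op_bounded (kappa^-1 *: diag_block A B gamma T t - 1%:M) delta.
  by move=> tT; apply: op_bounded_le (H_op _ _ tT) (op_bounded_opnorm _).
have E_bounded t : op_bounded (subdiag_block A B t) (kappa * theta).
  exact: op_bounded_le (E_op t) (op_bounded_opnorm _).
have y_bounded t : enorm (col_mx (y t) (y t.+1)) <= My.
  by apply: ub_le_sup => //; exists t.
have /choice[xstar xstarP] t : exists xs : 'cV[R]_n,
    xhat t T @[T --> \oo] --> xs /\ forall T, (t <= T)%N ->
      enorm (xhat t T - xs)
        <= 2 * (Num.sqrt (1 + delta) / (1 - eps) / (1 - theta / (1 - eps))
                / (1 - theta / (1 - eps)))
           * My * (theta / (1 - eps)) ^+ (T - t).
  have [xs cv hxs] := minimizer_converges gamma0 kappa1 theta0 delta0 delta1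
    theta_le theta_lt H_near E_bounded y_bounded xhat_min t.
  exists xs; split=> // T tT; apply: le_trans (hxs T tT) _.
  by rewrite le_eqVlt -/eps; apply/predU1P; left; move: (1 - _)^-1 => c; ring.
exists xstar; split=> [t|t T tT|b t T _].
- exact: (xstarP t).1.
- exact: (xstarP t).2.
(* The truncated value is the minimizer's frame [t] at horizon [t + b], where the convergence rate
   has exponent [b]. *)
rewrite trunc_finalE enorm_distC.
have Qu := Qblock_unit kappa1 theta0 delta1 theta_le H_near E_bounded.
rewrite (backsub_minimizer Qu gamma0 (xhat_min _)) ?leq_addl // addnK.
by have := (xstarP t).2 (t + b)%N (leq_addr _ _); rewrite addKn.
Qed.
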